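(* Let $\pi$ be a discrete group, let $X=K(\pi,1)$ be an Eilenberg–Mac Lane space (a connected CW complex), let $Y$ be a connected CW complex, and let $f\colon Y\to X$ be any map. Then $$\mathrm{dcat}_1(f)=\mathrm{dcat}(f).$$ In particular, $\mathrm{dcat}_1(\pi)=\mathrm{dcat}(\pi)$, where $\mathrm{dcat}_1(\pi):=\mathrm{dcat}_1(K(\pi,1))$ and $\mathrm{dcat}(\pi):=\mathrm{dcat}(K(\pi,1))$.
   Context: All spaces are connected CW complexes and maps are continuous. For a space $Z$ and an integer $n\ge 1$, let $\mathcal B_n(Z)$ be the set of probability measures on $Z$ supported on at most $n$ points, i.e. formal sums $\sum_{i=1}^n a_i z_i$ with $z_i\in Z$, $a_i\ge 0$, $\sum a_i=1$ (a point $z$ standing for the Dirac measure $\delta_z$). It carries the topology of weak convergence of measures; for metric $Z$ this is the topology of the Lévy–Prokhorov metric. For a map $p\colon E\to B$ put $E_n=\{\mu\in\mathcal B_n(E)\mid \mathrm{supp}(\mu)\subset p^{-1}(b)\text{ for some } b\in B\}$, a subspace of $\mathcal B_n(E)$, and let $p_n\colon E_n\to B$ send $\mu$ to that $b$. If $p$ is a fibration, then so is $p_n$. For a map $f\colon Y\to X$: $\mathrm{dcat}_1(f)$ is the least integer $n\ge 0$ such that $f$ lifts along $q^X_{n+1}\colon\widetilde X_{n+1}\to X$, where $q^X\colon\widetilde X\to X$ is the universal covering; $\mathrm{dcat}(f)$ is the least integer $n\ge 0$ such that $f$ lifts along $e^X_{n+1}\colon P_0(X)_{n+1}\to X$, where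 $P_0(X)$ is the space of paths $\phi\colon[0,1]\to X$ with $\phi(1)=x_0$ ($x_0$ a fixed basepoint) and $e^X(\phi)=\phi(0)$. These are $\infty$ if no such $n$ exists. $\mathrm{dcat}_1(X)=\mathrm{dcat}_1(1_X)$ and $\mathrm{dcat}(X)=\mathrm{dcat}(1_X)$. *)

(* Defs.v *)
From HB Require Import structures.
From mathcomp Require Import all_boot all_order all_algebra finmap.
From mathcomp Require Import all_classical all_reals all_analysis.

Set Implicit Arguments.
Unset Strict Implicit.
Unset Printing Implicit Defensive.

Import Order.TTheory GRing.Theory Num.Theory.
Import numFieldNormedType.Exports.

Local Open Scope classical_set_scope.
Local Open Scope ring_scope.

Section Cubes.
Variable R : realType.

Definition unit_interval : topologicalType := set_type (`[0, 1]%classic : set R).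

Lemma unit_interval0 : (0 : R) \in (`[0, 1]%classic : set R).
Proof. by apply/mem_set; rewrite /= in_itv /= lexx ler01. Qed.

Lemma unit_interval1 : (1 : R) \in (`[0, 1]%classic : set R).
Proof. by apply/mem_set; rewrite /= in_itv /= lexx ler01. Qed.

Definition I0 : unit_interval := exist _ 0 unit_interval0.
Definition I1 : unit_interval := exist _ 1 unit_interval1.

(* x as a point of [0,1]; I0, a junk value, if x lies outside [0,1] *)
Definition toI (x : R) : unit_interval :=
  insubd (I0 : set_type (`[0, 1]%classic : set R)) x.

Definition cube (n : nat) : topologicalType := {ptws 'I_n -> unit_interval}.

(* For n = 0 the cube is a point, its boundary is empty. *)
Definition cube_boundary (n : nat) : set (cube n) :=
  [set t | exists i : 'I_n, t i = I0 \/ t i = I1].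

Definition cube_interior (n : nat) : set (cube n) := ~` @cube_boundary n.

End Cubes.
Arguments cube_boundary {R n}.
Arguments cube_interior {R n}.

(* Whitehead's definition.  The cube [0,1]^n is the model of the closed       *)
(* n-disc, and D c @` cube_interior is the open cell of index c.  That D c is *)
(* a homeomorphism of the open cube onto the open cell follows from           *)
(* injectivity, the clauses on the boundary and X being Hausdorff.            *)
Record is_CW_structure (R : realType) (X : topologicalType) (cell : Type)
    (dim : cell -> nat) (D : forall c, cube R (dim c) -> X) : Prop := {
  CW_continuous : forall c, continuous (@D c) ;
  CW_injective : forall c, set_inj cube_interior (@D c) ;
  CW_disjoint : trivIset setT (fun c => @D c @` cube_interior) ;
  CW_cover : \bigcup_c (@D c @` cube_interior) = setT ;
  CW_boundary : forall c, exists F : set cell,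
    [/\ finite_set F, (forall d, F d -> (dim d < dim c)%N) &
        @D c @` cube_boundary `<=` \bigcup_(d in F) (@D d @` cube_interior)] ;
  CW_weak_topology : forall A : set X,
    closed A <-> forall c, closed (@D c @^-1` A) }.

Definition CW_complex (R : realType) (X : topologicalType) : Prop :=
  hausdorff_space X /\
  exists (cell : Type) (dim : cell -> nat) (D : forall c, cube R (dim c) -> X),
    is_CW_structure D.

Definition connected_CW (R : realType) (X : topologicalType) : Prop :=
  CW_complex R X /\ connected [set: X].

Section HomotopyGroups.
Variables (R : realType) (X : topologicalType).

(* maps of pairs (I^n, boundary) -> (X, x), representing pi_n(X, x) *)
Definition spheroid (n : nat) (x : X) : set (cube R n -> X) :=
  [set f | continuous f /\ forall t, cube_boundary t -> f t = x].

Definition homotopic_rel_boundary (n : nat) (f g : cube R n -> X) : Prop :=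
  exists H : cube R n * unit_interval R -> X,
    [/\ continuous H,
        forall t, H (t, I0 R) = f t,
        forall t, H (t, I1 R) = g t &
        forall t s, cube_boundary t -> H (t, s) = f t].

Definition trivial_homotopy_group (n : nat) (x : X) : Prop :=
  forall f, @spheroid n x f -> homotopic_rel_boundary f (cst x).

Definition loop_concat (f g : cube R 1 -> X) : cube R 1 -> X := fun t =>
  let s : R := set_val (t ord0) in
  if s <= 2^-1 then f (fun=> toI (2 * s)) else g (fun=> toI (2 * s - 1)).

(* phi induces a group isomorphism from pi_1(X, x), the homotopy classes of   *)
(* loops at x under concatenation, onto G.                                    *)
Definition fundamental_group_isog (x : X) (G : groupType) : Prop :=
  exists phi : (cube R 1 -> X) -> G,
    [/\ forall f g, @spheroid 1 x f -> @spheroid 1 x g ->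
          phi f = phi g <-> homotopic_rel_boundary f g,
        forall f g, @spheroid 1 x f -> @spheroid 1 x g ->
          phi (loop_concat f g) = (phi f * phi g)%g &
        forall c : G, exists2 f, @spheroid 1 x f & phi f = c].

Definition path_connected : Prop :=
  forall x y : X, exists a : unit_interval R -> X,
    [/\ continuous a, a (I0 R) = x & a (I1 R) = y].

Definition simply_connected : Prop :=
  path_connected /\ forall x, trivial_homotopy_group 1 x.

(* X is an Eilenberg-Mac Lane space K(G, 1) *)
Definition is_K_1 (G : groupType) : Prop :=
  [/\ connected [set: X],
      forall x, fundamental_group_isog x G &
      forall n, (1 < n)%N -> forall x, trivial_homotopy_group n x].

End HomotopyGroups.

Definition covering (E B : topologicalType) (q : E -> B) : Prop :=
  [/\ continuous q, set_surj setT setT q &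
      forall b : B, exists U : set B, open_nbhs b U /\
        exists sheets : set (set E),
          [/\ trivIset sheets id, \bigcup_(V in sheets) V = q @^-1` U &
              forall V, sheets V ->
                [/\ open V, set_bij V U q &
                    forall W, open W -> W `<=` V -> open (q @` W)]]].

Definition universal_covering (R : realType) (E B : topologicalType)
    (q : E -> B) : Prop :=
  covering q /\ simply_connected R E.

(* Finite formal sums of points with real coefficients, i.e. finitely         *)
(* supported (signed) measures, under the topology of weak convergence.       *)
Section WeakConvergence.
Variables (R : realType) (Z : topologicalType).

Definition formal_sum : Type := {fsfun Z -> R with 0}.
HB.instance Definition _ := Choice.on formal_sum.

Definition support (mu : formal_sum) : set Z := [set` finsupp mu].

Definition bounded_continuous : set (Z -> R) :=
  [set g | continuous g /\ bounded_fun g].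

Definition integrals (mu : formal_sum) : {ptws bounded_continuous -> R} :=
  fun g => \sum_(z <- finsupp mu) mu z * set_val g z.

HB.instance Definition _ :=
  Topological.copy formal_sum (initial_topology integrals).

Definition Bn (n : nat) : set formal_sum :=
  [set mu : formal_sum |
    [/\ forall z, 0 <= mu z, \sum_(z <- finsupp mu) mu z = 1 &
        (#|` finsupp mu| <= n)%N]].

End WeakConvergence.
Arguments bounded_continuous : clear implicits.

Section FibrewiseMeasures.
Variables (R : realType) (E B : topologicalType) (p : E -> B) (n : nat).

Definition En : set (formal_sum R E) :=
  [set mu : formal_sum R E |
    @Bn R E n mu /\ exists b, support mu `<=` p @^-1` [set b]].

(* The b with support mu `<=` p @^-1` [set b]; it is unique because  *)
(* the support of mu is not empty.                                            *)
Definition pn (mu : En) : B := projT1 (cid (proj2 (set_mem (valP mu)))).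

End FibrewiseMeasures.

Definition has_lift (E B Y : topologicalType) (p : E -> B) (f : Y -> B) : Prop :=
  exists2 g : Y -> E, continuous g & p \o g = f.

(* the least n such that P n; None, standing for infinity, if there is none *)
Definition least (P : nat -> Prop) : option nat :=
  if pselect (exists n, `[< P n >]) is left h then Some (ex_minn h) else None.

Section DistributionalCategory.
Variables (R : realType) (X : topologicalType).

Definition based_paths (x0 : X) :
    set {compact-open, unit_interval R -> X} :=
  [set phi | continuous (phi : unit_interval R -> X) /\ phi (I1 R) = x0].

Definition path_start (x0 : X) (phi : based_paths x0) : X :=
  (set_val phi : unit_interval R -> X) (I0 R).

(* to be used with q the universal covering of X *)
Definition dcat1 (Xt : topologicalType) (q : Xt -> X) (Y : topologicalType)
    (f : Y -> X) : option nat :=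
  least (fun n => has_lift (@pn R Xt X q n.+1) f).

Definition dcat (x0 : X) (Y : topologicalType) (f : Y -> X) : option nat :=
  least (fun n => has_lift (@pn R _ X (@path_start x0) n.+1) f).

Definition dcat1_space (Xt : topologicalType) (q : Xt -> X) : option nat :=
  dcat1 q (@id X).

Definition dcat_space (x0 : X) : option nat := dcat x0 (@id X).

End DistributionalCategory.

(* Main.v *)
Require Import Defs.
From mathcomp Require Import all_boot all_order all_algebra finmap.
From mathcomp Require Import all_classical all_reals all_analysis.
From mathcomp Require Import ring lra.

Set Implicit Arguments.
Unset Strict Implicit.
Unset Printing Implicit Defensive.

Import Order.TTheory GRing.Theory Num.Theory.
Import numFieldNormedType.Exports.

Local Open Scope classical_set_scope.
Local Open Scope ring_scope.

(* The universal covering q : Xt -> X and the path fibration P0(X) -> X map to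
   each other over X, and such maps act on finitely supported fibrewise
   measures by pushforward, so f lifts to one fibrewise measure space iff it
   lifts to the other.  P0(X) -> Xt lifts a path backwards from a fixed point
   over x0 and takes the starting point of the lift.  Xt -> P0(X) is the
   projection of the paths z ~> z0 traced by a contraction of Xt.  As Xt is
   aspherical, the contraction is built cell by cell over the lifts of the
   cells of X; Xt carries the weak topology with respect to these lifts, because
   q maps sets that are open for the lifted cells to sets that are open for the
   cells. *)

(** A map over [X] in each direction is enough, because pushforward turns it into a map of fibrewise
    measure spaces that preserves the bound on the support. A map from [Xt] to the based paths over
    [X] is a choice, continuous in [z], of a path from [q z] to [x0], and the tracks of a
    contraction give one. The contraction only has to end at [z0]; it may move [z0] on the way. The
    obstacle is the topology of [Xt]. No CW structure is put on it: the lifts of the characteristic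
    maps of [X] act as characteristic maps, and each point of [Xt] is interior to exactly one lifted
    cell, so a homotopy can be prescribed lift by lift. Extending it over a cell requires joint
    continuity in point and time on the boundary. That boundary lies over finitely many closed
    cells, whose union is coherent by compactness, and the time variable is handled by currying into
    a compact-open function space. *)

(** * Continuity and pasting *)

Section Continuity.
Variables (T U V : topologicalType).

Lemma continuous_open_nbhs (f : T -> U) (x : T) (O : set U) :
  {for x, continuous f} -> open O -> O (f x) -> nbhs x (f @^-1` O).
Proof. by move=> cf oO Ofx; apply: cf; exact: open_nbhs_nbhs. Qed.

Lemma continuous_comp2 (f : T -> U) (g : U -> V) :
  continuous f -> continuous g -> continuous (g \o f).
Proof. by move=> cf cg x; apply: continuous_comp; [exact: cf|exact: cg]. Qed.

Lemma continuous_pair (f : T -> U) (g : T -> V) :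
  continuous f -> continuous g -> continuous (fun x => (f x, g x)).
Proof. by move=> cf cg x; apply: cvg_pair; [apply: cf|apply: cg]. Qed.

Lemma continuous_fst : continuous (@fst U V).
Proof. by move=> x; exact: cvg_fst. Qed.

Lemma continuous_snd : continuous (@snd U V).
Proof. by move=> x; exact: cvg_snd. Qed.

Lemma continuous_cst (y : U) : continuous (fun _ : T => y).
Proof. by move=> x; exact: cvg_cst. Qed.

Lemma continuous_id : continuous (@id T).
Proof. by move=> x; exact: cvg_id. Qed.

Lemma closed_preimage (f : T -> U) (A : set U) :
  continuous f -> closed A -> closed (f @^-1` A).
Proof. by move/continuous_closedP; apply. Qed.

End Continuity.

Section Pasting.
Variables (R : realType) (T U V : topologicalType).

Lemma closed_sublevel (k : T -> R) (a : R) :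
  continuous k -> closed [set x | k x <= a].
Proof. by move=> ck; exact: (closed_preimage ck (@closed_le R a)). Qed.

Lemma closed_suplevel (k : T -> R) (a : R) :
  continuous k -> closed [set x | a <= k x].
Proof. by move=> ck; exact: (closed_preimage ck (@closed_ge R a)). Qed.

Lemma continuous_paste2 (A B : set T) (f : T -> U) :
  closed A -> closed B -> A `|` B = setT ->
  {within A, continuous f} -> {within B, continuous f} -> continuous f.
Proof.
move=> cA cB AB fA fB; have := withinU_continuous cA cB fA fB.
by rewrite AB => h x; have := h x; rewrite /continuous_at nbhs_subspaceT.
Qed.

Lemma within_eq (A : set T) (f g : T -> U) :
  {in A, f =1 g} -> continuous f -> {within A, continuous g}.
Proof.
move=> fg cf; apply: (subspace_eq_continuous fg).
exact: continuous_subspaceT.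
Qed.

Lemma continuous_ifle (k : T -> R) (a : R) (f g : T -> U) :
  continuous k -> continuous f -> continuous g ->
  (forall x, k x = a -> f x = g x) ->
  continuous (fun x => if k x <= a then f x else g x).
Proof.
move=> ck cf cg fg.
apply: (@continuous_paste2 [set x | k x <= a] [set x | a <= k x]).
- exact: closed_sublevel.
- exact: closed_suplevel.
- by apply/seteqP; split=> // x _; case: (leP (k x) a) => h; [left|right => /=; exact: ltW].
- by apply: within_eq cf => x; rewrite inE /= => ->.
- apply: within_eq cg => x; rewrite inE /= => ax.
  by case: ifP => // xa; apply/esym/fg/eqP; rewrite eq_le xa ax.
Qed.

Lemma within_continuous_comp2 (A : set T) (B : set U) (f : T -> U) (g : U -> V) :
  continuous f -> (forall x, A x -> B (f x)) -> {within B, continuous g} ->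
  {within A, continuous (g \o f)}.
Proof.
move=> cf AB /subspace_continuousP cg; apply/subspace_continuousP => x Ax.
apply: (@cvg_comp _ _ _ f g _ (within B (nbhs (f x)))); last exact: cg (AB _ Ax).
move=> N /= BN; have := cf x _ BN; rewrite /within /= /nbhs /=.
by apply: filterS => y h Ay; apply: h => //; exact: AB.
Qed.

End Pasting.

Lemma continuous_ptws (T V : topologicalType) (U : Type)
    (f : T -> {ptws U -> V}) :
  (forall u, continuous (fun x => f x u)) -> continuous f.
Proof.
move=> h x; apply/cvg_sup => u; apply/cvg_image.
  by apply/seteqP; split=> // y _; exists (fun=> y).
move=> A Ai; have H := h u x A Ai.
exists ((fun t : {ptws U -> V} => t u) @^-1` A) => //.
by apply/seteqP; split=> [_ [t ? <-] //|y Ay]; exists (fun=> y).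
Qed.

(** * The real line, the unit interval and cubes *)

Section RealLine.
Variable R : realType.
Local Notation I := (unit_interval R).

Lemma continuous_addr (T : topologicalType) (f g : T -> R) :
  continuous f -> continuous g -> continuous (fun x => f x + g x).
Proof. by move=> cf cg x; apply: cvgD; [apply: cf|apply: cg]. Qed.

Lemma continuous_subr (T : topologicalType) (f g : T -> R) :
  continuous f -> continuous g -> continuous (fun x => f x - g x).
Proof. by move=> cf cg x; apply: cvgB; [apply: cf|apply: cg]. Qed.

Lemma continuous_mulr (T : topologicalType) (f g : T -> R) :
  continuous f -> continuous g -> continuous (fun x => f x * g x).
Proof. by move=> cf cg x; apply: cvgM; [apply: cf|apply: cg]. Qed.

Lemma continuous_maxr (T : topologicalType) (f g : T -> R) :
  continuous f -> continuous g -> continuous (fun x => Num.max (f x) (g x)).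
Proof. by move=> cf cg x; apply: continuous_max; [apply: cf|apply: cg]. Qed.

Lemma continuous_minr (T : topologicalType) (f g : T -> R) :
  continuous f -> continuous g -> continuous (fun x => Num.min (f x) (g x)).
Proof. by move=> cf cg x; apply: continuous_min; [apply: cf|apply: cg]. Qed.

Lemma continuous_invr (T : topologicalType) (f : T -> R) :
  continuous f -> (forall x, f x != 0) -> continuous (fun x => (f x)^-1).
Proof. by move=> cf f0 x; apply: cvgV; [exact: f0|apply: cf]. Qed.

Lemma continuous_normr (T : topologicalType) (f : T -> R) :
  continuous f -> continuous (fun x => `|f x|).
Proof. by move=> cf x; apply: cvg_norm; apply: cf. Qed.

(** Connectedness as an induction principle: local propagation makes both [Q] and its complement
    open. Uniqueness of lifts, path lifting and continuity of lifted homotopies all rest on it. *)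
Lemma connected_indR (Q : R -> Prop) (a : R) :
  (forall x : R, exists2 N : set R, nbhs x N &
     forall y z, N y -> N z -> Q y -> Q z) ->
  Q a -> forall x, Q x.
Proof.
move=> loc Qa x.
have cR : connected [set: R] by apply/connected_intervalP.
have oQ : open [set y | Q y].
  rewrite openE => y Qy; have [N Ny NQ] := loc y.
  by apply: filterS (Ny) => z Nz; apply: (NQ y z) => //; exact: nbhs_singleton.
have cQ : closed [set y | Q y].
  rewrite -openC openE => y nQy; have [N Ny NQ] := loc y.
  apply: filterS (Ny) => z Nz /= Qz; apply: nQy.
  by apply: (NQ z y) => //; exact: nbhs_singleton.
suff QT : [set y | Q y] = setT by have : [set: R] x by []; rewrite -QT.
by apply: cR; [exists a|exists [set y | Q y] => //; rewrite setTI|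
  exists [set y | Q y] => //; rewrite setTI].
Qed.

(** Time runs over the whole line, retracted by [clamp]; it returns to the subtype only where
    nullhomotopies and based paths demand it. *)
Definition clamp (s : R) : R := Num.max 0 (Num.min 1 s).

Lemma clamp_ge0 s : 0 <= clamp s.
Proof. by rewrite /clamp le_max lexx. Qed.

Lemma clamp_le1 s : clamp s <= 1.
Proof. by rewrite /clamp ge_max ler01 ge_min lexx. Qed.

Lemma clamp_id s : 0 <= s <= 1 -> clamp s = s.
Proof. by move=> /andP[s0 s1]; rewrite /clamp (min_idPr s1) (max_idPr s0). Qed.

Lemma clamp_le0 s : s <= 0 -> clamp s = 0.
Proof.
by move=> s0; rewrite /clamp; apply/max_idPl; rewrite ge_min s0 orbT.
Qed.

Lemma clamp_ge1 s : 1 <= s -> clamp s = 1.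
Proof. by move=> s1; rewrite /clamp (min_idPl s1); apply/max_idPr. Qed.

Lemma continuous_clamp : continuous clamp.
Proof.
apply: continuous_maxr; first exact: continuous_cst.
by apply: continuous_minr; [exact: continuous_cst|exact: continuous_id].
Qed.

Definition toIc (s : R) : I := toI (clamp s).

Lemma val_toIc s : set_val (toIc s) = clamp s :> R.
Proof.
rewrite /toIc /toI /insubd; case: insubP => [u _ <- //|].
by move=> /negP[]; apply/mem_set; rewrite /= in_itv /= clamp_ge0 clamp_le1.
Qed.

Lemma valI_itv (t : I) : 0 <= (set_val t : R) <= 1.
Proof. by have /set_mem := valP t; rewrite /= in_itv. Qed.

Lemma valI_inj (t u : I) : set_val t = set_val u :> R -> t = u.
Proof. exact: val_inj. Qed.

Lemma toIcK (t : I) : toIc (set_val t) = t.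
Proof. by apply: valI_inj; rewrite val_toIc clamp_id // valI_itv. Qed.

Lemma toIc_le0 s : s <= 0 -> toIc s = I0 R.
Proof. by move=> s0; apply: valI_inj; rewrite val_toIc clamp_le0. Qed.

Lemma toIc_ge1 s : 1 <= s -> toIc s = I1 R.
Proof. by move=> s0; apply: valI_inj; rewrite val_toIc clamp_ge1. Qed.

Lemma continuous_valI : continuous (set_val : I -> R).
Proof. exact: initial_continuous. Qed.

Lemma continuous_toI (T : topologicalType) (f : T -> I) :
  continuous (fun x => set_val (f x) : R) -> continuous f.
Proof. by move=> h; apply: continuous_comp_initial. Qed.

Lemma continuous_toIc : continuous toIc.
Proof.
apply: continuous_toI; rewrite (_ : (fun _ => _) = clamp).
  exact: continuous_clamp.
by apply/funext => s; rewrite val_toIc.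
Qed.

Lemma compactI : compact [set: I].
Proof.
have -> : [set: I] = toIc @` `[0, 1]%classic.
  apply/seteqP; split=> // t _; exists (set_val t); last exact: toIcK.
  by rewrite /= in_itv /= valI_itv.
apply: continuous_compact; last exact: segment_compact.
by apply: continuous_subspaceT; exact: continuous_toIc.
Qed.

Lemma hausdorffI : hausdorff_space I.
Proof.
move=> x y h; apply: valI_inj; apply: (@Rhausdorff R).
move=> A B nA nB.
have [z [Az Bz]] := h _ _ (continuous_valI nA) (continuous_valI nB).
by exists (set_val z).
Qed.

Lemma locally_compactI : locally_compact [set: I].
Proof.
move=> x _; exists setT; first by rewrite withinET; exact: filterT.
by split; [exact: compactI|exact: closedT].
Qed.

Lemma continuous_cube (T : topologicalType) n (f : T -> cube R n) :
  (forall i, continuous (fun x => f x i)) -> continuous f.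
Proof. exact: continuous_ptws. Qed.

Lemma continuous_coord n (i : 'I_n) :
  continuous (fun t : cube R n => set_val (t i) : R).
Proof.
apply: (@continuous_comp2 _ _ _ (fun t : cube R n => t i)); last exact: continuous_valI.
exact: (@proj_continuous _ (fun _ => I) i).
Qed.

Lemma compact_cube n : compact [set: cube R n].
Proof.
have := @tychonoff 'I_n (fun=> I) (fun=> setT) (fun=> compactI).
congr compact.
by apply/seteqP; split.
Qed.

Lemma closed_cube_boundary n : closed (@cube_boundary R n).
Proof.
have -> : @cube_boundary R n = \bigcup_(i in [set: 'I_n])
   ([set t : cube R n | (set_val (t i) : R) <= 0] `|`
    [set t : cube R n | 1 <= (set_val (t i) : R)]).
  apply/seteqP; split=> t.
    by case=> i [] ti; exists i => //; [left|right]; rewrite /= ti /=.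
  case=> i _ [] /= ti; exists i; [left|right]; apply: valI_inj => /=.
    by apply/eqP; rewrite eq_le ti; have /andP[] := valI_itv (t i).
  by apply/eqP; rewrite eq_le ti andbT; have /andP[] := valI_itv (t i).
apply: closed_bigcup => [|i _]; first exact: finite_finset.
apply: closedU.
  by apply: closed_sublevel; exact: continuous_coord.
by apply: closed_suplevel; exact: continuous_coord.
Qed.

Definition cube_line n (t u : cube R n) (s : R) : cube R n :=
  fun i => toIc ((1 - s) * set_val (t i) + s * set_val (u i)).

Lemma cube_line0 n (t u : cube R n) : cube_line t u 0 = t.
Proof.
by apply/funext => i; rewrite /cube_line subr0 mul1r mul0r addr0 toIcK.
Qed.

Lemma cube_line1 n (t u : cube R n) : cube_line t u 1 = u.
Proof.
by apply/funext => i; rewrite /cube_line subrr mul0r mul1r add0r toIcK.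
Qed.

Lemma cube_line_refl n (t : cube R n) s : cube_line t t s = t.
Proof.
apply/funext => i; rewrite /cube_line -mulrDl addrNK mul1r; exact: toIcK.
Qed.

Lemma continuous_cube_line n (t : cube R n) :
  continuous (fun p : cube R n * R => cube_line t p.1 p.2).
Proof.
apply: continuous_cube => i.
suff h : continuous (fun p : cube R n * R =>
    (1 - p.2) * set_val (t i) + p.2 * set_val (p.1 i) : R).
  exact: (continuous_comp2 h continuous_toIc).
apply: continuous_addr.
  apply: continuous_mulr; last exact: continuous_cst.
  by apply: continuous_subr; [exact: continuous_cst|exact: continuous_snd].
apply: continuous_mulr; first exact: continuous_snd.
exact: (continuous_comp2 (@continuous_fst _ _) (@continuous_coord n i)).
Qed.

End RealLine.

(** * Unique path lifting and homotopy lifting for coverings *)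

Section Coverings.
Variables (R : realType) (E B : topologicalType) (q : E -> B).
Hypothesis covq : covering q.

Lemma covering_continuous : continuous q.
Proof. by case: covq. Qed.

Lemma covering_section (b : B) : exists U : set B,
  [/\ open U, U b & forall e, U (q e) -> exists V : set E, exists sec : B -> E,
    [/\ open V, V e, forall b', U b' -> V (sec b') /\ q (sec b') = b',
        forall e', V e' -> sec (q e') = e' &
        forall b', U b' -> {for b', continuous sec}]].
Proof.
have [_ _ /(_ b)[U [[oU Ub] [sheets [tS cS hS]]]]] := covq.
exists U; split=> // e Ue.
have : (q @^-1` U) e by [].
rewrite -cS => -[V SV Ve]; have [oV [fV iV sV] qV] := hS V SV.
pose sec b' := xget e [set e' | V e' /\ q e' = b'].
have secP b' : U b' -> V (sec b') /\ q (sec b') = b'.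
  move=> /sV[e' Ve' qe'].
  exact: (@xgetPex _ e [set e' | V e' /\ q e' = b'] (ex_intro _ e' (conj Ve' qe'))).
have secK e' : V e' -> sec (q e') = e'.
  move=> Ve'; have [Vs qs] := secP _ (fV _ Ve').
  by apply: iV => //; exact/mem_set.
exists V, sec; split=> // b' Ub'.
move=> N; rewrite nbhsE => -[W [oW Wb'] WN].
have [Vs qs] := secP _ Ub'.
have oqW : open (q @` (W `&` V)) by apply: qV; [exact: openI|move=> ? []].
have : nbhs b' (q @` (W `&` V)).
  by apply: open_nbhs_nbhs; split=> //; exists (sec b').
by apply: filterS => _ [w [Ww Vw] <-]; apply: WN; rewrite /= secK.
Qed.

Lemma covering_separated (e e' : E) : q e = q e' -> e <> e' ->
  exists V V' : set E, [/\ open V, open V', V e, V' e' & V `&` V' = set0].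
Proof.
move=> qee' ee'.
have [_ _ /(_ (q e))[U [[oU Ub] [sheets [tS cS hS]]]]] := covq.
have : (q @^-1` U) e by [].
rewrite -cS => -[V SV Ve].
have : (q @^-1` U) e' by rewrite /= -qee'.
rewrite -cS => -[V' SV' Ve'].
have [oV [fV iV sV] _] := hS V SV.
have [oV' _ _] := hS V' SV'.
exists V, V'; split=> //; apply: contrapT => /eqP/set0P/(tS _ _ SV SV') VV'.
by apply: ee'; apply: iV; rewrite ?VV' ?inE // -VV'.
Qed.

(** Where the lifts agree, both are the section of one sheet applied to the same path; where they
    differ, they stay on disjoint sheets. So agreement propagates locally. *)
Lemma lift_unique (f g : R -> E) (a : R) : continuous f -> continuous g ->
  (forall s, q (f s) = q (g s)) -> f a = g a -> forall s, f s = g s.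
Proof.
move=> cf cg fg; apply: (connected_indR (Q := fun s => f s = g s)) => s.
have [fgs|fgs] := pselect (f s = g s).
  have [U [oU Ub /(_ (f s) Ub)[V [sec [oV Ve secP secK _]]]]] := covering_section (q (f s)).
  exists (f @^-1` V `&` g @^-1` V).
    apply: filterI; first exact: (continuous_open_nbhs (cf s)).
    by apply: (continuous_open_nbhs (cg s)) => //; rewrite -fgs.
  by move=> y z _ [Vf Vg] _; rewrite -(secK _ Vf) -(secK _ Vg) fg.
have [V [V' [oV oV' Ve Ve' VV']]] := covering_separated (fg s) fgs.
exists (f @^-1` V `&` g @^-1` V').
  apply: filterI; first exact: (continuous_open_nbhs (cf s)).
  exact: (continuous_open_nbhs (cg s)).
move=> y z [/= Vy Vy'] _ yy; exfalso.
have : (V `&` V') (f y) by split=> //; rewrite yy.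
by rewrite VV'.
Qed.

Lemma path_lifting (gam : R -> B) (e0 : E) : continuous gam -> q e0 = gam 0 ->
  exists L : R -> E,
    [/\ continuous L, L 0 = e0 & forall s, q (L s) = gam (clamp s)].
Proof.
move=> cgam qe0.
(* [Num.max 0 s] leaves only [t = 0] to check for negative [s], so that the induction can run over
   the whole line. *)
pose Q (s : R) := exists L : R -> E, [/\ continuous L, L 0 = e0 &
  forall t, 0 <= t <= Num.max 0 s -> q (L t) = gam t].
suff [L [cL L0 qL]] : Q 1.
  exists (L \o @clamp R); split.
  - by apply: continuous_comp2 => //; exact: continuous_clamp.
  - by rewrite /= clamp_le0.
  - move=> s /=; apply: qL; rewrite clamp_ge0 /=.
    by apply: le_trans (clamp_le1 s) _; rewrite le_max lexx orbT.
apply: (connected_indR (Q := Q) (a := 0)) => [s0|]; last first.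
  exists (fun=> e0); split=> //; first exact: continuous_cst.
  by move=> t; rewrite maxxx -eq_le => /eqP <-.
have [U [oU Us hU]] := covering_section (gam s0).
have := continuous_open_nbhs (cgam s0) oU Us.
move=> /nbhs_ballP[eps /= eps0 ballU].
exists (ball s0 eps); first exact: nbhsx_ballx.
move=> y z; rewrite /ball /= => By Bz [L [cL L0 qL]].
have [zy|yz] := leP (Num.max 0 z) (Num.max 0 y).
  by exists L; split=> // t /andP[t0 tz]; apply: qL; rewrite t0 (le_trans tz).
set y' := Num.max 0 y in yz qL.
have y'0 : 0 <= y' by rewrite le_max lexx.
have z0 : 0 < z by move: yz; rewrite lt_max ltNge y'0 /=; exact: le_lt_trans.
have zE : Num.max 0 z = z by apply/max_idPr/ltW.
rewrite zE in yz.
have yy' : y <= y' by rewrite le_max lexx orbT.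
(* [c] retracts the line onto the segment from [y'] to [z], where [gam] stays in [U]; the
   continuation by [sec] is then continuous at all times. *)
pose c (t : R) := Num.max y' (Num.min z t).
have cU t : U (gam (c t)).
  apply: ballU; rewrite /ball /=.
  have c1 : y' <= c t by rewrite /c le_max lexx.
  have c2 : c t <= z by rewrite /c ge_max ltW //= ge_min lexx.
  move: By Bz; rewrite !ltr_norml => /andP[a1 a2] /andP[b1 b2].
  by apply/andP; split; lra.
have cc : continuous c.
  apply: continuous_maxr; first exact: continuous_cst.
  by apply: continuous_minr; [exact: continuous_cst|exact: continuous_id].
have cy' : c y' = y' by rewrite /c; apply/max_idPl; rewrite ge_min lexx orbT.
have qLy' : q (L y') = gam y' by apply: qL; rewrite y'0 lexx.
have [|V [sec [oV Ve secP secK csec]]] := hU (L y').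
  by rewrite qLy' -cy'.
exists (fun t => if t <= y' then L t else sec (gam (c t))); split.
- apply: (@continuous_ifle _ _ _ id) => //; first exact: continuous_id.
    move=> t; apply: (@continuous_comp _ _ _ (gam \o c)).
      by apply: continuous_comp2.
    exact: csec (cU t).
  by move=> t ->; rewrite cy' -qLy' secK.
- by rewrite y'0.
- move=> t; rewrite zE => /andP[t0 tz]; case: leP => ty.
    by apply: qL; rewrite t0.
  have -> : c t = t by rewrite /c (min_idPr tz); apply/max_idPr/ltW.
  by apply: (secP _ _).2; rewrite -[t in U (gam t)](_ : c t = t) //
    /c (min_idPr tz); apply/max_idPr/ltW.
Qed.

(* Lift each path separately.  Near (y0, s0) the base is evenly covered, so
   continuity in y at a single time near s0 forces joint continuity at all times
   near s0; hence continuity in y at time 0 propagates along the line. *)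
Lemma homotopy_lifting (Y : topologicalType) (H : Y * R -> B) (g : Y -> E) :
  continuous H -> continuous g -> (forall y, q (g y) = H (y, 0)) ->
  exists L : Y * R -> E, [/\ continuous L, forall y, L (y, 0) = g y &
    forall y s, q (L (y, s)) = H (y, clamp s)].
Proof.
move=> cH cg qg.
have cHy y : continuous (fun s => H (y, s)).
  apply: (continuous_comp2 _ cH).
  by apply: continuous_pair; [exact: continuous_cst|exact: continuous_id].
have /choice[L LP] : forall y, exists L : R -> E,
    [/\ continuous L, L 0 = g y & forall s, q (L s) = H (y, clamp s)].
  by move=> y; exact: (path_lifting (cHy y) (qg y)).
pose H' (p : Y * R) := H (p.1, clamp p.2).
have cH' : continuous H'.
  apply: (continuous_comp2 _ cH); apply: continuous_pair.
    exact: continuous_fst.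
  by apply: continuous_comp2; [exact: continuous_snd|exact: continuous_clamp].
pose C y0 s := {for y0, continuous (fun y => L y s)}.
have key y0 (s0 : R) : exists2 N : set R, nbhs s0 N & forall s, N s -> C y0 s ->
    forall t, N t -> {for (y0, t), continuous (fun p => L p.1 p.2)}.
  have [U [oU Us hU]] := covering_section (H' (y0, s0)).
  have [[A N'] /= [nA /nbhs_ballP[eps /= eps0 epsN]] AN] :=
    continuous_open_nbhs (cH' (y0, s0)) oU Us.
  have AU y t : A y -> ball s0 eps t -> U (H' (y, t)).
    by move=> Ay Bt; apply: AN; split=> //=; exact: epsN.
  exists (ball s0 eps); first exact: nbhsx_ballx.
  move=> s Bs Cs t Bt.
  have [Lc L0 qL] := LP y0.
  have [|V [sec [oV Ve secP secK csec]]] := hU (L y0 s).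
    by rewrite qL; apply: (AU y0 s) => //; exact: nbhs_singleton.
  (* Continuity at the single time [s] is used here: it keeps [L y s] on the sheet [V] for all [y]
     near [y0]. *)
  have nV : nbhs y0 (A `&` [set y | V (L y s)]).
    by apply: filterI => //; exact: (continuous_open_nbhs Cs).
  have LE y u : A y -> V (L y s) -> ball s0 eps u -> L y u = sec (H' (y, u)).
    move=> Ay Vy Bu.
    (* Along the segment from [s] to [u] the path [L y] and the path through [sec] lift the same
       path from the same point, so they agree at [u]. *)
    pose l (tau : R) := s + clamp tau * (u - s).
    have cl : continuous l.
      apply: continuous_addr; first exact: continuous_cst.
      apply: continuous_mulr; last exact: continuous_cst.
      exact: continuous_clamp.
    have lU tau : U (H' (y, l tau)).
      apply: AU => //; move: Bs Bu; rewrite /ball /= /l.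
      have := clamp_ge0 tau; have := clamp_le1 tau; move: (clamp tau) => c c1 c0.
      rewrite !ltr_norml => /andP[a1 a2] /andP[b1 b2].
      have [su|us] := leP s u.
        have h1 : 0 <= c * (u - s) by apply: mulr_ge0 => //; lra.
        have h2 : 0 <= (1 - c) * (u - s) by apply: mulr_ge0; lra.
        by apply/andP; split; lra.
      have h1 : 0 <= c * (s - u) by apply: mulr_ge0 => //; lra.
      have h2 : 0 <= (1 - c) * (s - u) by apply: mulr_ge0; lra.
      by apply/andP; split; lra.
    have [cLy _ qLy] := LP y.
    have := @lift_unique (fun tau => L y (l tau))
      (fun tau => sec (H' (y, l tau))) 0 _ _ _ _ 1.
    have -> : l 1 = u by rewrite /l clamp_id ?ler01 ?lexx // mul1r addrC subrK.
    apply.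
    - exact: continuous_comp2.
    - move=> tau; apply: (@continuous_comp _ _ _ (fun tau => H' (y, l tau))).
        apply: (continuous_comp2 _ cH').
        by apply: continuous_pair => //; exact: continuous_cst.
      exact: csec (lU tau).
    - by move=> tau; rewrite qLy (secP _ (lU tau)).2.
    - have -> : l 0 = s by rewrite /l clamp_le0 // mul0r addr0.
      by rewrite /H' /= -qLy secK.
  have Ay0 : A y0 by exact: nbhs_singleton.
  have cs : {for (y0, t), continuous (sec \o H')}.
    by apply: continuous_comp; [exact: cH'|apply: csec; exact: AU].
  move=> W; rewrite /= LE // => /cs.
  have nb : nbhs (y0, t) ((A `&` [set y | V (L y s)]) `*` ball s0 eps).
    exists (A `&` [set y | V (L y s)], ball s0 eps) => //; split=> //=.
    by apply: open_nbhs_nbhs; split=> //; exact: ball_open.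
  move=> /= nW; apply: filterS (filterI nb nW) => -[y u] /= [[[Ay Vy] Bu]].
  by rewrite LE.
have Call y0 s : C y0 s.
  apply: (connected_indR (Q := C y0) (a := 0)) => [s0|].
    have [N nN hN] := key y0 s0; exists N => // y z Ny Nz Cy.
    have := hN y Ny Cy z Nz => h.
    apply: (@continuous_comp _ _ _ (fun y => (y, z)) (fun p => L p.1 p.2)) => //.
    exact: (continuous_pair (@continuous_id Y) (@continuous_cst Y _ z)).
  rewrite /C (_ : (fun y => _) = g); first exact: cg.
  by apply/funext => y; case: (LP y).
exists (fun p => L p.1 p.2); split.
- by move=> [y s]; have [N nN hN] := key y s;
     have Ns := nbhs_singleton nN; exact: (hN s Ns (Call y s) s Ns).
- by move=> y /=; case: (LP y).
- by move=> y s /=; case: (LP y).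
Qed.

End Coverings.

(** * Extension of homotopies from the boundary of a cube *)

Section BoxExtension.
Variables (R : realType) (n : nat).
Local Notation I := (unit_interval R).
Local Notation boundary := (@cube_boundary R n).

Definition offset (t : cube R n) (i : 'I_n) : R := set_val (t i) - 2^-1.

(** The sup-norm distance from the centre; the boundary lies at distance 1/2. For [n = 0] the
    default value 0 fits the empty boundary. *)
Definition radius (t : cube R n) : R := \big[Num.max/0]_(i < n) `|offset t i|.

Lemma continuous_offset i : continuous (fun t => offset t i).
Proof.
by apply: continuous_subr; [exact: continuous_coord|exact: continuous_cst].
Qed.

Lemma continuous_radius : continuous radius.
Proof.
rewrite /radius; elim: (index_enum _) => [|i r IH].
  rewrite (_ : (fun _ => _) = fun=> 0); first exact: continuous_cst.
  by apply/funext => t; rewrite big_nil.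
rewrite (_ : (fun _ => _) = fun t => Num.max `|offset t i|
    (\big[Num.max/0]_(j <- r) `|offset t j|)).
  apply: continuous_maxr => //; apply: continuous_normr.
  exact: continuous_offset.
by apply/funext => t; rewrite big_cons.
Qed.

Lemma offset_bound t i : `|offset t i| <= 2^-1.
Proof.
by have /andP[t0 t1] := valI_itv (t i); rewrite /offset ler_norml; apply/andP; split; lra.
Qed.

Lemma offset_radius t i : `|offset t i| <= radius t.
Proof. exact: le_bigmax. Qed.

Lemma radius_bound t : radius t <= 2^-1.
Proof. by apply: bigmax_le => [|i _]; [lra|exact: offset_bound]. Qed.

Lemma radius_attained t : 0 < radius t -> exists i, `|offset t i| = radius t.
Proof.
move=> m0; apply: contrapT => h.
suff : radius t < radius t by rewrite ltxx.
rewrite {1}/radius; apply: bigmax_lt => // i _.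
rewrite lt_neqAle offset_radius andbT.
by apply/eqP => e; apply: h; exists i.
Qed.

Lemma radius_boundary t : boundary t -> radius t = 2^-1.
Proof.
case=> i ti; apply/eqP; rewrite eq_le radius_bound /=.
apply: le_trans (offset_radius t i).
rewrite /offset; case: ti => ->.
  by rewrite (_ : set_val (I0 R) = 0 :> R) // add0r normrN ger0_norm // invr_ge0.
by rewrite (_ : set_val (I1 R) = 1 :> R) // ger0_norm; lra.
Qed.

(* The point (t, s) is projected from the point 2 above the centre of the cube
   onto the bottom and the sides; [stretch] is the dilation factor. *)
Definition height (t : cube R n) (s : R) : R :=
  Num.max (4 * radius t) (2 - clamp s).

Definition stretch t s : R := 2 / height t s.

Definition box_retraction (p : cube R n * R) : cube R n * R :=
  ((fun i => toIc (2^-1 + stretch p.1 p.2 * offset p.1 i)) : cube R n,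
   2 - stretch p.1 p.2 * (2 - clamp p.2)).

Lemma height_ge1 t s : 1 <= height t s.
Proof. by rewrite /height le_max; apply/orP; right; have := clamp_le1 s; lra. Qed.

Lemma continuous_stretch :
  continuous (fun p : cube R n * R => stretch p.1 p.2).
Proof.
apply: continuous_mulr; first exact: continuous_cst.
apply: continuous_invr => [|p]; last by have := height_ge1 p.1 p.2; case: eqP => //; lra.
apply: continuous_maxr.
  apply: continuous_mulr; first exact: continuous_cst.
  by apply: continuous_comp2; [exact: continuous_fst|exact: continuous_radius].
apply: continuous_subr; first exact: continuous_cst.
by apply: continuous_comp2; [exact: continuous_snd|exact: continuous_clamp].
Qed.

Lemma continuous_box_retraction : continuous box_retraction.
Proof.
apply: continuous_pair; last first.
  apply: continuous_subr; first exact: continuous_cst.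
  apply: continuous_mulr; first exact: continuous_stretch.
  apply: continuous_subr; first exact: continuous_cst.
  by apply: continuous_comp2; [exact: continuous_snd|exact: continuous_clamp].
apply: continuous_cube => i.
suff h : continuous (fun p : cube R n * R =>
    2^-1 + stretch p.1 p.2 * offset p.1 i : R).
  exact: (continuous_comp2 h (@continuous_toIc R)).
apply: continuous_addr; first exact: continuous_cst.
apply: continuous_mulr; first exact: continuous_stretch.
exact: (continuous_comp2 (@continuous_fst _ _) (@continuous_offset i)).
Qed.

(** Dilation factor 1. On the bottom the term [2 - clamp s] dominates, on the sides [4 * radius t],
    in both cases with value 2. *)
Lemma box_retraction_id t s : height t s = 2 -> box_retraction (t, s) = (t, clamp s).
Proof.
move=> hE; rewrite /box_retraction /stretch /= hE divff // !mul1r.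
congr (_, _); last by lra.
by apply/funext => i; rewrite mul1r /offset addrC subrK toIcK.
Qed.

Lemma box_retraction_bottom t s : s <= 0 -> box_retraction (t, s) = (t, 0).
Proof.
move=> s0; rewrite box_retraction_id ?clamp_le0 //.
rewrite /height clamp_le0 // subr0; apply/max_idPr.
by have := radius_bound t; lra.
Qed.

Lemma box_retraction_side t s : boundary t ->
  box_retraction (t, s) = (t, clamp s).
Proof.
move=> bt; rewrite box_retraction_id // /height radius_boundary //.
by rewrite (max_idPl _) //; have := clamp_ge0 s; lra.
Qed.

(** The ray from the apex meets the bottom at dilation [2 / (2 - clamp s)] and a side at
    [2 / (4 * radius t)]. [stretch] is the smaller of the two, and the term attaining the maximum in
    [height] tells which face is hit. *)
Lemma box_retraction_image p :
  (box_retraction p).2 = 0 \/ boundary (box_retraction p).1.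
Proof.
have := height_ge1 p.1 p.2; rewrite /box_retraction /stretch /=.
set h := height _ _ => h1.
have [hE|hE] : h = 4 * radius p.1 \/ h = 2 - clamp p.2.
- by rewrite /h /height; case: (leP (4 * radius p.1)); [right|left].
- right; have [|i iE] := @radius_attained p.1; first by lra.
  exists i; have : `|2 / h * offset p.1 i| = 2^-1.
    rewrite normrM iE ger0_norm ?divr_ge0 //; last by lra.
    by rewrite -mulrA -[in RHS](mulfV (_ : h != 0)); [rewrite hE; field; lra|lra].
  move/eqP; rewrite eqr_norml => /andP[/orP[]/eqP-> _]; [right|left].
    by apply: toIc_ge1; lra.
  by apply: toIc_le0; lra.
- by left; rewrite -hE mulfVK ?subrr //; lra.
Qed.

Lemma box_extension (Z : topologicalType) (a : cube R n -> Z)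
    (h : cube R n * R -> Z) :
  continuous a -> {within boundary `*` setT, continuous h} ->
  (forall t, boundary t -> h (t, 0) = a t) ->
  exists F : cube R n * R -> Z,
    [/\ continuous F, forall t (s : R), s <= 0 -> F (t, s) = a t &
        forall t s, boundary t -> F (t, s) = h (t, clamp s)].
Proof.
move=> ca ch ha.
(* [w] joins [a] on the bottom to [h] on the sides. Only its values on the image of the retraction
   count, and there the two closed pieces paste. *)
pose w (p : cube R n * R) := if pselect (boundary p.1) then h p else a p.1.
have w0 p : p.2 = 0 -> w p = a p.1.
  by case: p => t s /= ->; rewrite /w /=; case: pselect => // bt; exact: ha.
have wb p : boundary p.1 -> w p = h p by rewrite /w; case: pselect.
pose r := box_retraction.
have cr : continuous r := continuous_box_retraction.
have cr1 : continuous (fun p => (r p).1).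
  exact: (continuous_comp2 cr (@continuous_fst _ _)).
have cr2 : continuous (fun p => (r p).2).
  exact: (continuous_comp2 cr (@continuous_snd _ _)).
exists (w \o r); split; last 2 first.
- by move=> t s s0; rewrite /= /r box_retraction_bottom // w0.
- by move=> t s bt; rewrite /= /r box_retraction_side // wb.
apply: (@continuous_paste2 _ _ [set p | (r p).2 = 0] [set p | boundary (r p).1]).
- exact: (closed_preimage cr2 (@closed_eq R 0)).
- exact: (closed_preimage cr1 (@closed_cube_boundary R n)).
- by apply/seteqP; split=> // p _; exact: box_retraction_image.
- apply: (within_eq (f := a \o (fun p => (r p).1))); last exact: continuous_comp2.
  by move=> p; rewrite inE => pE; rewrite /comp w0.
- apply: (@subspace_eq_continuous _ _ _ (h \o r)).
    by move=> p; rewrite inE => pE; exact: esym (wb (r p) pE).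
  by apply: (within_continuous_comp2 cr _ ch) => p.
Qed.

(* On the boundary the homotopy [h] is constant from time [tau] on; inside the
   cube the cell is contracted between the times [tau] and [tau']. *)
Lemma cell_extension (Z : topologicalType) (z0 : Z) (tau tau' : R)
    (a : cube R n -> Z) (h : cube R n * R -> Z) :
  trivial_homotopy_group R n z0 -> 0 <= tau -> tau < tau' -> tau' <= 1 ->
  continuous a -> {within boundary `*` setT, continuous h} ->
  (forall t (s : R), boundary t -> s <= 0 -> h (t, s) = a t) ->
  (forall t s, boundary t -> tau <= s -> h (t, s) = z0) ->
  exists F : cube R n * R -> Z,
    [/\ continuous F, forall t (s : R), s <= 0 -> F (t, s) = a t,
        forall t s, boundary t -> F (t, s) = h (t, s) &
        forall t s, tau' <= s -> F (t, s) = z0].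
Proof.
move=> tZ tau0 tautau' tau'1 ca ch h0 h1.
have [F0 [cF0 F00 F0b]] := box_extension ca ch (fun t bt => h0 t 0 bt (lexx 0)).
(* The clamping in [box_extension] is harmless: over the boundary [h] is stationary before time 0
   and after time 1. *)
have F0h t s : boundary t -> F0 (t, s) = h (t, s).
  move=> bt; rewrite F0b //.
  have [s0|s0] := leP s 0; first by rewrite clamp_le0 // !h0.
  have [s1|s1] := leP 1 s; first by rewrite clamp_ge1 // !h1 //; lra.
  by rewrite clamp_id // !ltW.
(* At time [tau] the boundary already sits at [z0], so this is a spheroid at [z0], and its
   nullhomotopy fills the remaining time. *)
have [|H [cH H0 H1 Hb]] := tZ (fun t => F0 (t, tau)).
  split; last by move=> t bt; rewrite F0h // h1.
  apply: (continuous_comp2 _ cF0).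
  by apply: continuous_pair; [exact: continuous_id|exact: continuous_cst].
pose c (s : R) := (s - tau) / (tau' - tau).
exists (fun p => if p.2 <= tau then F0 p else H (p.1, toIc (c p.2))); split.
- apply: continuous_ifle => //; first exact: continuous_snd.
    apply: (continuous_comp2 _ cH); apply: continuous_pair.
      exact: continuous_fst.
    have cc : continuous c.
      apply: continuous_mulr; last exact: continuous_cst.
      by apply: continuous_subr; [exact: continuous_id|exact: continuous_cst].
    exact: (continuous_comp2 (continuous_comp2 (@continuous_snd _ _) cc) (@continuous_toIc R)).
  by move=> [t s] /= ->; rewrite /c subrr mul0r toIc_le0 // H0.
- by move=> t s s0 /=; rewrite (le_trans s0 tau0) F00.
- move=> t s bt /=; case: leP => st; first exact: F0h.
  by rewrite Hb // F0h // !h1 // ltW.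
- move=> t s st /=; case: leP => st'; first by exfalso; lra.
  by rewrite toIc_ge1 ?H1 // /c ler_pdivlMr ?mul1r; lra.
Qed.

End BoxExtension.

(** * Lifts of cubes and homotopy groups of a covering space *)

Section CubeLifts.
Variables (R : realType) (E B : topologicalType) (q : E -> B).
Hypothesis covq : covering q.

Lemma cube_lift_unique n (f g : cube R n -> E) (t0 : cube R n) :
  continuous f -> continuous g -> (forall t, q (f t) = q (g t)) ->
  f t0 = g t0 -> f = g.
Proof.
move=> cf cg fg fg0; apply/funext => t.
have cl : continuous (cube_line t0 t).
  apply: (@continuous_comp2 _ _ _ (fun s : R => (t, s))
    (fun p : cube R n * R => cube_line t0 p.1 p.2)).
    by apply: continuous_pair; [exact: continuous_cst|exact: continuous_id].
  exact: continuous_cube_line.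
have := @lift_unique R _ _ _ covq (f \o cube_line t0 t) (g \o cube_line t0 t) 0.
move=> /(_ _ _ _ _ 1); rewrite /= cube_line0 cube_line1; apply => //.
- exact: continuous_comp2.
- exact: continuous_comp2.
Qed.

(** Homotopy lifting along the straight-line expansion of the cube from [t0], starting at the
    constant map [e0]. *)
Lemma cube_lift n (f : cube R n -> B) (t0 : cube R n) (e0 : E) :
  continuous f -> q e0 = f t0 ->
  exists g : cube R n -> E,
    [/\ continuous g, forall t, q (g t) = f t & g t0 = e0].
Proof.
move=> cf qe0.
have cH : continuous (fun p : cube R n * R => f (cube_line t0 p.1 p.2)).
  exact: (@continuous_comp2 _ _ _ (fun p : cube R n * R => cube_line t0 p.1 p.2)
    f (continuous_cube_line (t := t0)) cf).
have [|t|L [cL L0 qL]] := homotopy_lifting covq cH (g := fun=> e0).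
- exact: continuous_cst.
- by rewrite /= cube_line0.
exists (fun t => L (t, 1)); split.
- apply: (continuous_comp2 _ cL).
  by apply: continuous_pair; [exact: continuous_id|exact: continuous_cst].
- by move=> t; rewrite qL clamp_ge1 //= cube_line1.
- apply: (lift_unique covq (f := fun s => L (t0, s)) (g := fun=> e0) (a := 0)) => //.
  + apply: (continuous_comp2 _ cL).
    by apply: continuous_pair; [exact: continuous_cst|exact: continuous_id].
  + exact: continuous_cst.
  + by move=> s; rewrite qL /= cube_line_refl qe0.
Qed.

(** A nullhomotopy below is lifted; by uniqueness of lifts it stays fixed on the boundary. Its end
    lies over a constant map and takes the value [e] at a boundary point, so it is constant. The
    degree is positive to provide that boundary point. *)
Lemma trivial_homotopy_group_covering n (e : E) :
  trivial_homotopy_group R n.+1 (q e) -> trivial_homotopy_group R n.+1 e.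
Proof.
move=> tB f [cf fb].
have cq := covering_continuous covq.
have [|H [cH H0 H1 Hb]] := tB (q \o f).
  by split; [exact: continuous_comp2|move=> t bt /=; rewrite fb].
have cH' : continuous (fun p : cube R n.+1 * R => H (p.1, toIc p.2)).
  apply: (continuous_comp2 _ cH); apply: continuous_pair.
    exact: continuous_fst.
  exact: (continuous_comp2 (@continuous_snd _ _) (@continuous_toIc R)).
have [//|t|L [cL L0 qL]] := homotopy_lifting covq cH' (g := f).
  by rewrite /= toIc_le0 // H0.
have Lb t s : cube_boundary t -> L (t, s) = f t.
  move=> bt; rewrite -(L0 t).
  apply: (lift_unique covq (f := fun s => L (t, s)) (g := fun=> L (t, 0)) (a := 0)) => //.
  - apply: (continuous_comp2 _ cL).
    by apply: continuous_pair; [exact: continuous_cst|exact: continuous_id].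
  - exact: continuous_cst.
  - by move=> u; rewrite !qL /= !Hb.
have L1 t : L (t, 1) = e.
  pose t1 : cube R n.+1 := fun=> I0 R.
  have bt1 : cube_boundary t1 by exists ord0; left.
  have := @cube_lift_unique _ (fun t => L (t, 1)) (fun=> e) t1.
  move=> h; suff /(congr1 (@^~ t)) : (fun t => L (t, 1)) = fun=> e by [].
  apply: h.
  - apply: (continuous_comp2 _ cL).
    by apply: continuous_pair; [exact: continuous_id|exact: continuous_cst].
  - exact: continuous_cst.
  - by move=> u; rewrite qL /= toIc_ge1 ?H1 // clamp_ge1.
  - by rewrite Lb // fb.
exists (fun p => L (p.1, set_val p.2)); split.
- apply: (continuous_comp2 _ cL); apply: continuous_pair.
    exact: continuous_fst.
  exact: (continuous_comp2 (@continuous_snd _ _) (@continuous_valI R)).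
- by move=> t; exact: L0.
- by move=> t; exact: L1.
- by move=> t s bt /=; exact: Lb.
Qed.

End CubeLifts.

(** The 0-cube is a point without boundary, so in degree 0 a nullhomotopy is a path to [z]. *)
Lemma trivial_homotopy_group0 (R : realType) (Z : topologicalType) (z : Z) :
  path_connected R Z -> trivial_homotopy_group R 0 z.
Proof.
move=> pZ f _; pose t0 : cube R 0 := fun=> I0 R.
have cube0 (t : cube R 0) : t = t0 by apply/funext; case.
have [a [ca a0 a1]] := pZ (f t0) z.
exists (fun p => a p.2); split=> //.
- exact: (continuous_comp2 (@continuous_snd _ _) ca).
- by move=> t; rewrite a0 (cube0 t).
- by move=> t s [[]].
Qed.

(** Degree 0 is included because vertices too must be moved to [z0]. Simple connectivity gives
    degrees 0 and 1, the higher homotopy groups of [X] the rest. *)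
Lemma universal_cover_aspherical (R : realType) (G : groupType)
    (X Xt : topologicalType) (q : Xt -> X) :
  is_K_1 R X G -> universal_covering R q ->
  forall n (z : Xt), trivial_homotopy_group R n z.
Proof.
move=> [_ _ tX] [covq [pc sc]] [|[|n]] z.
- exact: trivial_homotopy_group0.
- exact: sc.
- by apply: (trivial_homotopy_group_covering covq); exact: tX.
Qed.

(** * The weak topology of the covering space *)

Section LiftedCells.
Variables (R : realType) (X : topologicalType) (cell : Type)
  (dim : cell -> nat) (D : forall c, cube R (dim c) -> X).
Hypotheses (hX : hausdorff_space X) (CW : is_CW_structure D).
Variables (Xt : topologicalType) (q : Xt -> X).
Hypothesis covq : covering q.

Definition cell_lift c (d : cube R (dim c) -> Xt) : Prop :=
  continuous d /\ forall t, q (d t) = D t.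

Definition closed_cells (P : set cell) : set X := \bigcup_(c in P) range (@D c).

(** Isolates what the weak topology provides. It is applied to the set of all cells, and to the
    finite sets covering the boundary of one cell, which need not form subcomplexes. *)
Definition coherent (P : set cell) : Prop := forall A : set X,
  A `<=` closed_cells P -> (forall c, P c -> closed (@D c @^-1` A)) -> closed A.

Lemma coherentT : coherent setT.
Proof. by move=> A _ cA; apply/(CW_weak_topology CW) => c; exact: cA. Qed.

(** [A] is a finite union of images of compact sets, each closed because [X] is Hausdorff. *)
Lemma coherent_finite (P : set cell) : finite_set P -> coherent P.
Proof.
move=> fP A AP cA.
have -> : A = \bigcup_(c in P) (@D c @` (@D c @^-1` A)).
  apply/seteqP; split=> x.
    by move=> Ax; have [c Pc [t _ tx]] := AP x Ax; exists c => //; exists t;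
       rewrite /= ?tx.
  by case=> c _ [t /= At <-].
apply: (@closed_bigcup _ {classic cell}) => // c Pc; apply: compact_closed => //.
apply: continuous_compact.
  by apply: continuous_subspaceT; exact: (CW_continuous CW).
by apply: subclosed_compact (@compact_cube R _) _ => //; exact: cA.
Qed.

Lemma lift_through c (t : cube R (dim c)) (z : Xt) : D t = q z ->
  exists2 d, cell_lift (c := c) d & d t = z.
Proof.
move=> Dtz; have := cube_lift covq (@CW_continuous _ _ _ _ _ CW c) (esym Dtz).
by case=> d [cd qd dt]; exists d.
Qed.

(* The sets [O] that are open for the lifted cells have images [q @` O] that are
   open for the cells: near a point of its preimage a cell lifts into [O]. *)
Lemma coherent_continuous (P : set cell) (T : topologicalType) (S : Xt -> T) :
  coherent P ->
  (forall c d, P c -> cell_lift (c := c) d -> continuous (S \o d)) ->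
  {within q @^-1` closed_cells P, continuous S}.
Proof.
move=> cohP cS; apply/subspace_continuousP => e Me N; rewrite nbhsE.
move=> -[N' [oN' N'e] N'N]; rewrite /within /nbhs /=.
have [U [oU Ue /(_ e Ue)[V [sec [oV Ve secP secK _]]]]] := covering_section covq (q e).
pose K := closed_cells P.
(* Staying on one sheet [V] loses nothing under [q]: two points of [V] over the same point coincide,
   so membership in [W] can be pulled back at the end. *)
pose W := q @` (V `&` (q @^-1` K `&` S @^-1` N')).
have cKW : closed (K `\` W).
  apply: cohP => [x []//|c Pc].
  have -> : @D c @^-1` (K `\` W) = ~` (@D c @^-1` W).
    apply/seteqP; split=> [t [] //|t nW]; split=> //.
    by exists c => //; exists t.
  rewrite closedC openE => t [e1 [Ve1 [Me1 Ne1]] qe1].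
  have [d dl dt] := lift_through (esym qe1).
  have [cd qd] := dl.
  have n1 : nbhs t (d @^-1` V).
    by apply: (continuous_open_nbhs (cd t)) => //; rewrite dt.
  have n2 : nbhs t ((S \o d) @^-1` N').
    by apply: (continuous_open_nbhs (cS _ _ Pc dl t)) => //=; rewrite dt.
  apply: filterS (filterI n1 n2) => u [/= Vu Nu]; exists (d u) => //.
  by split=> //; split=> //=; rewrite qd; exists c => //; exists u.
have We : W (q e) by exists e.
have n1 : nbhs e (q @^-1` (~` (K `\` W))).
  have cq : continuous q := covering_continuous covq.
  apply: (continuous_open_nbhs (cq e)).
    exact: closed_openC.
  by case.
have n2 : nbhs e V by exact: open_nbhs_nbhs.
apply: filterS (filterI n1 n2) => e' [/= nKW Ve'] Me'; apply: N'N.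
have [e2 [Ve2 [_ Ne2]] qe2] : W (q e').
  by apply: contrapT => nW; apply: nKW.
by rewrite -(secK e' Ve') -qe2 secK.
Qed.

(** The weak topology survives the product with the locally compact line: curry, test on the cells
    with values in the compact-open function space, and uncurry. *)
Lemma coherent_continuous2 (P : set cell) (Z : topologicalType)
    (S : Xt -> R -> Z) :
  coherent P ->
  (forall c d, P c -> cell_lift (c := c) d ->
     continuous (fun p : cube R (dim c) * R => S (d p.1) p.2)) ->
  {within q @^-1` closed_cells P `*` setT, continuous (fun p => S p.1 p.2)}.
Proof.
move=> cohP cS; set M := q @^-1` _.
(* Uncurrying asks for a continuous path at every point, hence the constant path off [M]. *)
pose S' z : {compact-open, R -> Z} :=
  if pselect (M z) then S z else fun=> S z 0.
have S'E z : M z -> S' z = S z by rewrite /S'; case: pselect.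
have Md c d t : P c -> cell_lift (c := c) d -> M (d t).
  by move=> Pc [_ qd]; exists c => //; exists t.
have cS' : {within M, continuous S'}.
  apply: coherent_continuous => // c d Pc dl.
  have -> : S' \o d = curry (fun p : cube R (dim c) * R => S (d p.1) p.2).
    by apply/funext => t /=; rewrite S'E //; exact: Md dl.
  exact: continuous_curry_fun (cS c d Pc dl).
have cS'z z : continuous (S' z).
  have [Mz|nMz] := pselect (M z); last first.
    have -> : S' z = fun=> S z 0 by rewrite /S'; case: pselect.
    exact: continuous_cst.
  rewrite S'E //; have [c Pc [t _ Dt]] := Mz.
  have [d dl <-] := lift_through Dt.
  apply: (@continuous_comp2 _ _ _ (fun s : R => (t, s))
    (fun p : cube R (dim c) * R => S (d p.1) p.2)); last exact: cS Pc dl.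
  by apply: continuous_pair; [exact: continuous_cst|exact: continuous_id].
have cu := @continuous_uncurry (subspace M) R Z S' (@locally_compactR R)
  (@Rhausdorff R) cS' cS'z.
apply/subspace_continuousP => -[z s] [/= Mz _] N nN.
have := cu (z, s) N; rewrite /= S'E // => /(_ nN) [[A1 A2] /= [nA1 nA2] AN].
have nA1' : nbhs z [set x | M x -> A1 x].
  by move: nA1; rewrite /= /nbhs /= -nbhs_subspace_in.
rewrite /within /nbhs /=; exists ([set x | M x -> A1 x], A2) => //.
move=> [x u] /= [Ax Au] [Mx _].
by have := AN (x, u); rewrite /= S'E //; apply; split=> //; exact: Ax.
Qed.

End LiftedCells.

(** * Contraction of the covering space, cell by cell *)

Section Contraction.
Variables (R : realType) (X : topologicalType) (cell : Type)
  (dim : cell -> nat) (D : forall c, cube R (dim c) -> X).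
Hypotheses (hX : hausdorff_space X) (CW : is_CW_structure D).
Variables (Xt : topologicalType) (q : Xt -> X) (z0 : Xt).
Hypotheses (covq : covering q)
  (asphXt : forall n (z : Xt), trivial_homotopy_group R n z).

Local Notation lift := (@cell_lift R X cell dim D Xt q).
Local Notation lifted_point :=
  {c : cell & (cube R (dim c) * (cube R (dim c) -> Xt))%type}.

Definition lies_at (z : Xt) (w : lifted_point) : Prop :=
  let: existT c (t, d) := w in [/\ cube_interior t, lift d & d t = z].

Lemma lies_at_ex z : exists w, lies_at z w.
Proof.
have : [set: X] (q z) by [].
rewrite -(CW_cover CW) => -[c _ [t it Dt]].
by have [d dl dt] := lift_through CW covq Dt; exists (existT _ c (t, d)).
Qed.

Lemma open_cell_unique c c' (t : cube R (dim c)) (t' : cube R (dim c')) :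
  cube_interior t -> cube_interior t' -> D t = D t' -> c = c'.
Proof.
move=> it it' tt'; apply: (CW_disjoint CW) => //.
by exists (D t); split; [exists t|exists t'].
Qed.

(** Disjointness of the open cells of [X] determines the cell, injectivity on the interior the
    parameter, and uniqueness of lifts the lift. So functions on [Xt] may be defined from
    [position]. *)
Lemma lies_at_unique z w w' : lies_at z w -> lies_at z w' -> w = w'.
Proof.
case: w w' => c [t d] [c' [t' d']] [it [cd qd] dt] [it' [cd' qd'] dt'].
have DD : D t = D t' by rewrite -qd -qd' dt dt'.
have cc := open_cell_unique it it' DD.
case: _ / cc t' d' it' cd' qd' dt' DD => t' d' it' cd' qd' dt' DD.
have tt : t = t' by apply: (CW_injective CW) DD; exact/mem_set.
rewrite -tt in dt' *; suff -> : d = d' by [].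
apply: (cube_lift_unique covq (t0 := t)) => //; last by rewrite dt.
by move=> u; rewrite qd qd'.
Qed.

Definition position z : lifted_point := sval (cid (lies_at_ex z)).

Definition cell_dim z : nat := dim (projT1 (position z)).

Lemma position_spec z : lies_at z (position z).
Proof. exact: svalP (cid (lies_at_ex z)). Qed.

Lemma position_lift c (t : cube R (dim c)) d : cube_interior t -> lift d ->
  position (d t) = existT _ c (t, d).
Proof. by move=> it dl; apply: lies_at_unique (position_spec _) _. Qed.

Lemma cell_dim_boundary c (t : cube R (dim c)) d : cube_boundary t -> lift d ->
  (cell_dim (d t) < dim c)%N.
Proof.
move=> bt [cd qd]; have [F [_ dF bF]] := CW_boundary CW c.
have [|c' Fc' [t' it' Dt']] := bF (D t); first by exists t.
have [d' dl' dt'] := lift_through CW covq (etrans Dt' (esym (qd t))).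
by rewrite /cell_dim -dt' position_lift //=; exact: dF.
Qed.

Lemma cell_dim_lift c (t : cube R (dim c)) d : lift d ->
  (cell_dim (d t) <= dim c)%N.
Proof.
move=> dl; have [bt|it] := pselect (cube_boundary t).
  exact/ltnW/cell_dim_boundary.
by rewrite /cell_dim position_lift.
Qed.

(** The cells of dimension [n] reach [z0] between [stage n] and [stage n.+1], starting from
    [stage 0 = 0]. *)
Definition stage (n : nat) : R := 1 - 2^-1 ^+ n.

Lemma stage_ge0 n : 0 <= stage n.
Proof. by rewrite subr_ge0 exprn_ile1 // ?invr_ge0 // invf_le1 // ler1n. Qed.

Lemma stage_le1 n : stage n <= 1.
Proof. by rewrite gerBl exprn_ge0 // invr_ge0. Qed.

Lemma stage_lt n : stage n < stage n.+1.
Proof.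
have : 0 < (2^-1 : R) ^+ n by rewrite exprn_gt0 // invr_gt0.
by rewrite /stage exprS; lra.
Qed.

Lemma stage_mono m n : (m <= n)%N -> stage m <= stage n.
Proof.
move=> /subnK <-; elim: (n - m)%N => [|k IH] //.
by rewrite addSn (le_trans IH) // ltW // stage_lt.
Qed.

(* As [stage k.+1 < 1], the homotopy on a cell of dimension k has reached [z0]
   strictly before time 1, so no infinite concatenation arises. *)
Definition contracts_cell (S : Xt -> R -> Xt) c (d : cube R (dim c) -> Xt) :=
  [/\ continuous (fun p : cube R (dim c) * R => S (d p.1) p.2),
      forall t s, s <= 0 -> S (d t) s = d t &
      forall t s, stage (dim c).+1 <= s -> S (d t) s = z0].

(** The strict bound makes [n = 0] vacuous, so the vertices are treated by the general step. *)
Definition contracts_skeleton (n : nat) (S : Xt -> R -> Xt) : Prop :=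
  forall c d, (dim c < n)%N -> lift d -> @contracts_cell S c d.

(** A boundary point lies on a lifted cell of dimension at most [n - 1], which is at [z0] from
    [stage n] on. This is the situation of [cell_extension]. *)
Lemma contracts_extend_cell n S c d : contracts_skeleton n S -> dim c = n ->
  lift d -> exists F : cube R (dim c) * R -> Xt,
    [/\ continuous F, forall t s, s <= 0 -> F (t, s) = d t,
        forall t s, cube_boundary t -> F (t, s) = S (d t) s &
        forall t s, stage n.+1 <= s -> F (t, s) = z0].
Proof.
move=> gS dn dl; have [cd qd] := dl.
have Sb t : cube_boundary t -> exists c' d' t',
    [/\ (dim c' < n)%N, @cell_lift _ _ _ _ D _ q c' d' & d' t' = d t].
  move=> bt; have := cell_dim_boundary bt dl; rewrite dn.
  have := position_spec (d t); rewrite /cell_dim.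
  by case: (position (d t)) => c' [t' d'] /= [_ d'l d't'] c'n; exists c', d', t'.
apply: (cell_extension (tau := stage n) (tau' := stage n.+1)
  (h := fun p => S (d p.1) p.2)) => //.
- exact: stage_ge0.
- exact: stage_lt.
- exact: stage_le1.
- have [F [fF dF bF]] := CW_boundary CW c.
  have cS := coherent_continuous2 CW covq (coherent_finite hX CW fF)
    (S := S) (fun c' d' Fc' d'l => let: And3 h _ _ := gS c' d'
       (leq_trans (dF _ Fc') (eq_leq dn)) d'l in h).
  have cdd : continuous (fun p : cube R (dim c) * R => (d p.1, p.2)).
    apply: continuous_pair; last exact: continuous_snd.
    exact: (continuous_comp2 (@continuous_fst _ _) cd).
  apply: (within_continuous_comp2 cdd _ cS) => -[t s] [/= bt _]; split=> //=.
  have [|c' Fc' [t' _ Dt']] := bF (D t); first by exists t.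
  by rewrite /= qd; exists c' => //; exists t'.
- by move=> t s /Sb[c' [d' [t' [c'n d'l <-]]]] s0; have [_ + _] := gS c' d' c'n d'l; apply.
- move=> t s /Sb[c' [d' [t' [c'n d'l <-]]]] s0; have [_ _] := gS c' d' c'n d'l; apply.
  by apply: le_trans s0; exact: stage_mono.
Qed.

(** The second clause makes the sequence of homotopies stationary at each point. *)
Lemma contracts_step n S : contracts_skeleton n S -> exists S',
  contracts_skeleton n.+1 S' /\
  forall z, (cell_dim z < n)%N -> S' z = S z.
Proof.
move=> gS.
have Fex c (d : cube R (dim c) -> Xt) : exists F : cube R (dim c) * R -> Xt,
    dim c = n -> lift d ->
    [/\ continuous F, forall t s, s <= 0 -> F (t, s) = d t,
        forall t s, cube_boundary t -> F (t, s) = S (d t) s &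
        forall t s, stage n.+1 <= s -> F (t, s) = z0].
  have [[dn dl]|h] := pselect (dim c = n /\ lift d).
    by have [F FP] := contracts_extend_cell gS dn dl; exists F.
  by exists (fun=> z0) => dn dl; exfalso; apply: h.
pose F c d := sval (cid (Fex c d)).
have FP c d : dim c = n -> lift d ->
    [/\ continuous (F c d), forall t s, s <= 0 -> F c d (t, s) = d t,
        forall t s, cube_boundary t -> F c d (t, s) = S (d t) s &
        forall t s, stage n.+1 <= s -> F c d (t, s) = z0].
  exact: svalP (cid (Fex c d)).
(* Uniqueness of [position] glues the pieces [F c d] into one function; at the boundary of an
   [n]-cell it is still [S], in agreement with [F c d]. *)
pose S' z s := if cell_dim z == n then
  let w := position z in F (projT1 w) (projT2 w).2 ((projT2 w).1, s) else S z s.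
have S'low z : (cell_dim z < n)%N -> S' z = S z.
  by move=> zn; apply/funext => s; rewrite /S' ltn_eqF.
exists S'; split=> // c d; rewrite ltnS leq_eqVlt => /orP[/eqP dn|dn] dl.
  have S'F t s : S' (d t) s = F c d (t, s).
    have [cF F0 Fb F1] := FP c d dn dl.
    have [bt|it] := pselect (cube_boundary t).
      have lown : (cell_dim (d t) < n)%N by rewrite -dn; exact: cell_dim_boundary.
      by rewrite (S'low _ lown) Fb.
    by rewrite /S' /cell_dim position_lift //=; case: eqP.
  have [cF F0 Fb F1] := FP c d dn dl; split.
  - have -> : (fun p : cube R (dim c) * R => S' (d p.1) p.2) = F c d.
      by apply/funext => -[t s]; rewrite S'F.
    exact: cF.
  - by move=> t s s0; rewrite S'F F0.
  - by move=> t s; rewrite dn => s1; rewrite S'F F1.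
have [cS S0 S1] := gS c d dn dl.
have S'd t : S' (d t) = S (d t).
  by apply: S'low; apply: leq_ltn_trans dn; exact: cell_dim_lift.
split=> [|t s s0|t s s1]; rewrite ?S'd; [|exact: S0|exact: S1].
have -> : (fun p : cube R (dim c) * R => S' (d p.1) p.2) =
    fun p => S (d p.1) p.2.
  by apply/funext => p; rewrite S'd.
exact: cS.
Qed.

(** On each lifted cell the limit equals a single term of the sequence. Continuity is left cellwise,
    the form in which [coherent_continuous] consumes it. *)
Lemma contraction_exists : exists S : Xt -> R -> Xt,
  [/\ forall c d, lift d ->
        continuous (fun p : cube R (dim c) * R => S (d p.1) p.2),
      forall z, S z 0 = z & forall z, S z 1 = z0].
Proof.
have good0 : contracts_skeleton 0 (fun _ _ => z0) by [].
pose next n (S : {S | contracts_skeleton n S}) :=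
  cid (contracts_step (svalP S)).
pose seqS := nat_rect (fun n => {S | contracts_skeleton n S})
  (exist _ _ good0) (fun n S => exist _ (sval (next n S)) (svalP (next n S)).1).
have seqS_step n z : (cell_dim z < n)%N ->
    sval (seqS n.+1) z = sval (seqS n) z.
  exact: (svalP (next n (seqS n))).2.
have seqS_stable n z : (cell_dim z < n)%N ->
    sval (seqS n) z = sval (seqS (cell_dim z).+1) z.
  move=> /subnK <-; elim: (n - _)%N => [|k IH] //.
  by rewrite addSn seqS_step // leq_addl.
pose S z := sval (seqS (cell_dim z).+1) z.
have SE c (d : cube R (dim c) -> Xt) : lift d ->
    forall t, S (d t) = sval (seqS (dim c).+1) (d t).
  move=> dl t; rewrite /S -(@seqS_stable (dim c).+1) //.
  exact: cell_dim_lift.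
have gS c (d : cube R (dim c) -> Xt) : lift d -> @contracts_cell S c d.
  move=> dl; have [cS S0 S1] : contracts_cell (sval (seqS (dim c).+1)) d.
    exact: (svalP (seqS (dim c).+1)).
  split=> [|t s s0|t s s1]; rewrite ?SE //; [|exact: S0|exact: S1].
  have -> : (fun p : cube R (dim c) * R => S (d p.1) p.2) =
      fun p => sval (seqS (dim c).+1) (d p.1) p.2.
    by apply/funext => p; rewrite SE.
  exact: cS.
exists S; split=> [c d dl|z|z]; first by have [] := gS c d dl.
- have := position_spec z; case: (position z) => c [t d] [it dl <-].
  by have [_ + _] := gS c d dl; apply.
- have := position_spec z; case: (position z) => c [t d] [it dl <-].
  by have [_ _] := gS c d dl; apply; exact: stage_le1.
Qed.

End Contraction.

(** * Image measures and weak convergence *)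

Section Pushforward.
Variables (R : realType) (E E' : topologicalType) (u : E -> E').

Definition pushforward (mu : formal_sum R E) : formal_sum R E' :=
  [fsfun y in (u @` finsupp mu)%fset =>
     \sum_(z <- finsupp mu | u z == y) mu z | 0].

Lemma pushforwardE mu y :
  pushforward mu y = \sum_(z <- finsupp mu | u z == y) mu z.
Proof.
rewrite fsfunE; case: ifPn => // ny; rewrite big_seq_cond big1 // => z.
move=> /andP[zmu /eqP uz]; case/negP: ny; apply/imfsetP.
by exists z.
Qed.

(** Only an inclusion, since signed coefficients may cancel within a fibre of [u]. *)
Lemma finsupp_pushforward mu :
  (finsupp (pushforward mu) `<=` u @` finsupp mu)%fset.
Proof. exact: finsupp_sub. Qed.

(** Change of variables; with [g] constant 1 it is conservation of mass. *)
Lemma sum_pushforward mu (g : E' -> R) :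
  \sum_(y <- finsupp (pushforward mu)) pushforward mu y * g y =
  \sum_(z <- finsupp mu) mu z * g (u z).
Proof.
rewrite (big_fset_incl _ (finsupp_pushforward mu)) /=; last first.
  by move=> y _ ny; rewrite fsfun_dflt // mul0r.
under eq_bigr do rewrite pushforwardE big_distrl /=.
rewrite (exchange_big_dep xpredT) //=.
rewrite !big_seq; apply: eq_bigr => z zmu.
have uz : u z \in (u @` finsupp mu)%fset by apply/imfsetP; exists z.
rewrite big_mkcond (big_fsetD1 _ uz) /= eqxx big_seq big1 ?addr0 // => y.
by rewrite !inE => /andP[/negPf yz _]; rewrite eq_sym yz.
Qed.

Hypothesis cu : continuous u.

(** Integrating [g] against the image measure is integrating [g \o u], which is again a bounded
    continuous test function. *)
Lemma continuous_pushforward : continuous pushforward.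
Proof.
apply: continuous_comp_initial.
apply: continuous_ptws => g.
have [cg bg] := set_mem (valP g).
have gu : bounded_continuous R E (set_val g \o u).
  split; first exact: (continuous_comp2 cu cg).
  by case: bg => M [Mr hM]; exists M; split=> // N MN x _; exact: (hM N MN (u x) I).
pose gu' : bounded_continuous R E := exist _ (set_val g \o u) (mem_set gu).
have intE nu : integrals (pushforward nu) g = integrals nu gu'.
  exact: sum_pushforward.
rewrite (_ : (fun _ => _) = fun nu => integrals nu gu'); last first.
  by apply/funext => nu; exact: intE.
apply: (@continuous_comp2 _ _ _ (@integrals R E) (fun f => f gu')).
  exact: initial_continuous.
exact: (@proj_continuous _ (fun=> R : topologicalType) gu').
Qed.

Lemma Bn_pushforward n mu : @Bn R E n mu -> @Bn R E' n (pushforward mu).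
Proof.
move=> [m0 m1 mn]; split.
- by move=> y; rewrite pushforwardE sumr_ge0.
- have := sum_pushforward mu (fun=> 1).
  by under eq_bigr do rewrite mulr1; under [RHS]eq_bigr do rewrite mulr1; rewrite m1.
- apply: leq_trans (fsubset_leq_card (finsupp_pushforward mu)) _.
  apply: leq_trans (leq_imfset_card _ _ _) _.
  exact: mn.
Qed.

Lemma support_pushforward mu :
  Defs.support (pushforward mu) `<=` u @` Defs.support mu.
Proof.
move=> y /(fsubsetP (finsupp_pushforward mu))/imfsetP[z /= zmu ->].
by exists z.
Qed.

End Pushforward.

Lemma Bn_support (R : realType) (E : topologicalType) n (mu : formal_sum R E) :
  Bn n mu -> exists z, Defs.support mu z.
Proof.
move=> [_ m1 _]; apply: contrapT => h.
have s0 : finsupp mu = fset0.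
  by apply/eqP/fset0Pn => -[z zmu]; apply: h; exists z.
by have := oner_neq0 R; rewrite -m1 s0 big_seq_fset0 eqxx.
Qed.

Lemma pn_support (R : realType) (E B : topologicalType) (p : E -> B) n
     (mu : @En R E B p n) z : Defs.support (set_val mu) z ->
  pn mu = p z.
Proof. by move=> /(projT2 (cid (proj2 (set_mem (valP mu))))). Qed.

Section FibrewiseMap.
Variables (R : realType) (E E' B : topologicalType) (p : E -> B) (p' : E' -> B).

Lemma has_lift_pn n (Y : topologicalType) (f : Y -> B) (u : E -> E') :
  continuous u -> (forall e, p' (u e) = p e) ->
  has_lift (@pn R E B p n) f -> has_lift (@pn R E' B p' n) f.
Proof.
move=> cu pu [g cg gf].
have EnP (mu : @En R E B p n) : @En R E' B p' n (pushforward u (set_val mu)).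
  have [Bmu [b mub]] := set_mem (valP mu).
  split; first exact: Bn_pushforward.
  by exists b => _ /support_pushforward[z /mub <- <-]; exact: pu.
pose v (mu : @En R E B p n) : @En R E' B p' n :=
  exist _ (pushforward u (set_val mu)) (mem_set (EnP mu)).
have cv : continuous v.
  apply: continuous_comp_initial.
  apply: (@continuous_comp2 _ _ _ (set_val : @En R E B p n -> formal_sum R E)
    (pushforward u)); first exact: initial_continuous.
  exact: continuous_pushforward.
exists (v \o g); first exact: continuous_comp2.
rewrite -gf; apply/funext => y /=.
(* A point supporting the image measure comes from one supporting the original; [pn] is read off at
   these two points. *)
have [z' z'mu] := Bn_support (proj1 (set_mem (valP (v (g y))))).
have [z zmu uz] := support_pushforward z'mu.
by rewrite (pn_support (mu := v (g y)) z'mu) (pn_support zmu) -uz pu.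
Qed.

End FibrewiseMap.

(** * Comparison of the covering with the path fibration *)

Section PathFibration.
Variables (R : realType) (X Xt : topologicalType) (q : Xt -> X) (x0 : X).
Hypothesis covq : covering q.

(** The whole path space is the parameter space of one homotopy lifting, which makes the end of the
    lift depend continuously on the path. *)
Lemma lift_paths : exists u : @based_paths R X x0 -> Xt,
  continuous u /\ forall phi, q (u phi) = path_start phi.
Proof.
have [_ /(_ x0 I)[e0 _ qe0] _] := covq.
pose ev (phi : @based_paths R X x0) : {compact-open, unit_interval R -> X} :=
  set_val phi.
have cev : continuous (uncurry (ev : _ -> _ -> X)).
  apply: continuous_uncurry.
  - exact: locally_compactI.
  - exact: hausdorffI.
  - exact: initial_continuous.
  - by move=> phi; case: (set_mem (valP phi)).
pose H (z : @based_paths R X x0 * R) := uncurry (ev : _ -> _ -> X) (z.1, toIc (1 - z.2)).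
have cH : continuous H.
  apply: (continuous_comp2 _ cev); apply: continuous_pair.
    exact: continuous_fst.
  have c1 : continuous (fun s : R => 1 - s).
    by apply: continuous_subr; [exact: continuous_cst|exact: continuous_id].
  exact: (continuous_comp2 (continuous_comp2 (@continuous_snd _ _) c1)
    (@continuous_toIc R)).
have [|phi|L [cL L0 qL]] := homotopy_lifting covq cH (g := fun=> e0).
- exact: continuous_cst.
- rewrite /H /= subr0 toIc_ge1 // qe0.
  by case: (set_mem (valP phi)).
- exists (fun phi => L (phi, 1)); split.
    apply: (continuous_comp2 _ cL).
    by apply: continuous_pair; [exact: continuous_id|exact: continuous_cst].
  by move=> phi; rewrite qL /H /= clamp_ge1 // subrr toIc_le0.
Qed.

Lemma contract_to_paths (CWX : CW_complex R X)
    (asph : forall n (z : Xt), trivial_homotopy_group R n z) :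
  exists v : Xt -> @based_paths R X x0,
    continuous v /\ forall z, path_start (v z) = q z.
Proof.
have [hX [cell [dim [D CW]]]] := CWX.
have cq : continuous q := covering_continuous covq.
have [_ /(_ x0 I)[z0 _ qz0] _] := covq.
have [S [cS S0 S1]] := contraction_exists hX CW z0 covq asph.
(* The point [z0] was chosen over [x0], so all projected tracks end at [x0]. *)
pose T z : {compact-open, unit_interval R -> X} := fun s => q (S z (set_val s)).
have cSd c (d : cube R (dim c) -> Xt) : @cell_lift _ _ _ _ D _ q c d ->
    continuous (fun p : cube R (dim c) * unit_interval R => T (d p.1) p.2).
  move=> dl; apply: (@continuous_comp2 _ _ _
    (fun p : cube R (dim c) * unit_interval R => S (d p.1) (set_val p.2)) q) => //.
  apply: (@continuous_comp2 _ _ _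
    (fun p : cube R (dim c) * unit_interval R => (p.1, set_val p.2 : R))
    (fun p : cube R (dim c) * R => S (d p.1) p.2)); last exact: cS.
  apply: continuous_pair; first exact: continuous_fst.
  exact: (continuous_comp2 (@continuous_snd _ _) (@continuous_valI R)).
have cT : continuous T.
  have := coherent_continuous CW covq (coherentT CW) (S := T).
  have -> : q @^-1` closed_cells D setT = setT.
    apply/seteqP; split=> // z _; have : [set: X] (q z) by [].
    by rewrite -(CW_cover CW) => -[c _ [t _ Dt]]; exists c => //; exists t.
  move=> h z; rewrite /continuous_at -nbhs_subspaceT; apply: h => c d _ dl.
  exact: continuous_curry_fun (cSd c d dl).
have Tz z : @based_paths R X x0 (T z).
  split; last by rewrite /T S1.
  have := position_spec CW covq z; case: position => c [t d] [_ dl <-].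
  have := cSd c d dl; move/continuous_curry => [_ /(_ t)]; exact.
exists (fun z => exist _ (T z) (mem_set (Tz z))); split.
  exact: continuous_comp_initial.
move=> z; have T0 : T z (I0 R) = q z by rewrite /T S0.
exact: T0.
Qed.

End PathFibration.

Theorem proposition3p5 (R : realType) (G : groupType) (X : topologicalType)
    (x0 : X) (Xt : topologicalType) (q : Xt -> X)
    (cwX : connected_CW R X) (KX : is_K_1 R X G)
    (univq : universal_covering R q) :
  (forall (Y : topologicalType) (f : Y -> X),
      connected_CW R Y -> continuous f -> dcat1 R q f = dcat R x0 f) /\
  dcat1_space R q = dcat_space R x0.
Proof.
have covq : covering q by case: univq.
have [u [cu qu]] := lift_paths R x0 covq.
have [v [cv pv]] := contract_to_paths x0 covq (proj1 cwX)
  (universal_cover_aspherical KX univq).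
suff dcatE (Y : topologicalType) (f : Y -> X) : dcat1 R q f = dcat R x0 f.
  by split=> [Y f _ _|]; exact: dcatE.
(* The admissible [n] are the same on both sides, so the minima agree, also when there are none. *)
congr least; apply/funext => n; apply/propext.
by split; [exact: has_lift_pn cv pv|exact: has_lift_pn cu qu].
Qed.
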